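(* Let $\mathbb{G}$ be a $2$-step Carnot group, let $x_0\in\mathbb{G}$ and let $P_0=(P_H(0),P_{H_2})$ with $P_H(0)\in H$, $|P_H(0)|=1$, and $P_{H_2}\in H_2$. Then the normal CC-geodesic starting from $x_0$ with initial momentum $P_0$ is given, in exponential coordinates, by $$\exp_{SR}(x_0,P_0)(t)=x_0+\int_0^te^{-C_H(P_{H_2})s}P_H(0)\,ds-\frac12\sum_{\alpha=h+1}^n\Big(\int_0^t\langle C_H^\alpha x_H(s),\dot x_H(s)\rangle\,ds\Big)\,\mathrm{e}_\alpha ,$$ where $x_H(t)=x_H(0)+\int_0^te^{-C_H(P_{H_2})s}P_H(0)\,ds\in\mathbb{R}^h$ and $x_H(0)\in\mathbb{R}^h$ is the vector of the first $h$ coordinates of $x_0$.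
   Context: A $2$-step Carnot group $\mathbb{G}$ is a connected, simply connected nilpotent Lie group of dimension $n$ whose Lie algebra is stratified: $\mathfrak{g}=H\oplus H_2$, $[H,H]=H_2$, $[H,H_2]=0$; $h=\dim H$. Fix a basis $\mathrm{e}_1,\dots,\mathrm{e}_n$ of $\mathfrak{g}$ with $\mathrm{e}_1,\dots,\mathrm{e}_h$ spanning $H$ and $\mathrm{e}_{h+1},\dots,\mathrm{e}_n$ spanning $H_2$, let $X_1,\dots,X_n$ be the corresponding left-invariant vector fields, and take the left-invariant metric $\langle\cdot,\cdot\rangle$ making them orthonormal. $\mathbb{G}$ is identified with $\mathfrak{g}\cong\mathbb{R}^n$ via exponential coordinates of the first kind; vectors of $\mathbb{R}^h$ are regarded as elements of $\mathrm{span}(\mathrm{e}_1,\dots,\mathrm{e}_h)$. Structural constants: $C^R_{IJ}:=\langle[X_I,X_J],X_R\rangle$. For $\alpha=h+1,\dots,n$, $C_H^\alpha=[C^\alpha_{ij}]_{i,j=1,\dots,h}$, and for $P_{H_2}=\sum_{\alpha>h}P_\alpha X_\alpha$, $C_H(P_{H_2})=\sum_{\alpha>h}P_\alpha C_H^\alpha$ (an $h\times h$ matrix); $e^A$ denotes the matrix exponential. The normal CC-geodesic $x(t)=\exp_{SR}(x_0,P_0)(t)$ is defined by the normal equations $$\dot x=P_H=\sum_{i=1}^hP_iX_i(x),\qquad \dot P_H=-C_H(P_{H_2})P_H,\qquad \dot P_{H_2}=0,$$ with $x(0)=x_0$ and $(P_H,P_{H_2})(0)=P_0$. *)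

(* Defs.v *)
From HB Require Import structures.
From mathcomp Require Import all_boot all_order all_algebra.
From mathcomp Require Import all_classical all_reals all_analysis.
Set Implicit Arguments.
Unset Strict Implicit.
Unset Printing Implicit Defensive.
Import Order.TTheory GRing.Theory Num.Theory.
Import numFieldNormedType.Exports.
Local Open Scope classical_set_scope.
Local Open Scope ring_scope.

(* Euclidean inner product and norm. The library norm [`|u|] of a matrix is the
   sup norm, hence the explicit [enorm]. *)
Definition dotv (R : realType) (n : nat) (u v : 'cV[R]_n) : R :=
  \sum_(i < n) u i 0 * v i 0.

Definition enorm (R : realType) (n : nat) (u : 'cV[R]_n) : R :=
  Num.sqrt (dotv u u).

(* The oriented integral, so that time may also run backwards. *)
Definition oint (R : realType) (a b : R) (f : R -> R) : R :=
  if a <= b then \int[lebesgue_measure]_(s in `[a, b]) f s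
  else - \int[lebesgue_measure]_(s in `[b, a]) f s.

Definition vint (R : realType) (n : nat) (a b : R) (f : R -> 'cV[R]_n) :
  'cV[R]_n := \col_(i < n) oint a b (fun s => f s i 0).

Definition expmx (R : realType) (n : nat) (A : 'M[R]_n) : 'M[R]_n :=
  limn (series (fun k : nat => (k`!%:R)^-1 *: A ^+ k)).

Definition e_ (R : realType) (n : nat) (I : 'I_n) : 'cV[R]_n := delta_mx I 0.

(* The span of the brackets of elements of U and W; since [br] will be bilinear,
   bases of U and W suffice (compare [prodv]). *)
Definition bracketv (R : realType) (n : nat)
    (br : 'cV[R]_n -> 'cV[R]_n -> 'cV[R]_n) (U W : {vspace 'cV[R]_n}) :
  {vspace 'cV[R]_n} := <<[seq br u w | u <- vbasis U, w <- vbasis W]>>%VS.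

Definition horizontal (R : realType) (h m : nat) : {vspace 'cV[R]_(h + m)} :=
  <<[seq e_ R (lshift m i) | i <- enum 'I_h]>>%VS.

Definition vertical (R : realType) (h m : nat) : {vspace 'cV[R]_(h + m)} :=
  <<[seq e_ R (rshift h a) | a <- enum 'I_m]>>%VS.

(* A 2-step stratified Lie algebra, written in an adapted basis: the carrier is
   R^n with n = h + m, the first h basis vectors span H, the last m span H_2.
   Through exponential coordinates of the first kind the associated connected,
   simply connected Lie group has the same carrier; see [gmul]. *)
Record carnot2 (R : realType) (h m : nat) := Carnot2 {
  lie :> 'cV[R]_(h + m) -> 'cV[R]_(h + m) -> 'cV[R]_(h + m);
  lie_linearl : forall (a : R) u v w, lie (a *: u + v) w = a *: lie u w + lie v w;
  lie_linearr : forall (a : R) u v w, lie w (a *: u + v) = a *: lie w u + lie w v;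
  lie_alt : forall u, lie u u = 0;
  lie_jacobi : forall u v w,
    lie u (lie v w) + lie v (lie w u) + lie w (lie u v) = 0;
  lie_HH : bracketv lie (horizontal R h m) (horizontal R h m) = vertical R h m;
  lie_HH2 : bracketv lie (horizontal R h m) (vertical R h m) = 0%VS
}.

Section CarnotGroup.
Context (R : realType) (h m : nat) (G : carnot2 R h m).
Local Notation V := 'cV[R]_(h + m).

(* The group law in exponential coordinates of the first kind,
   log (exp x exp y): the Baker-Campbell-Hausdorff series, which stops after the
   first bracket in step 2. *)
Definition gmul (x y : V) : V := x + y + 2^-1 *: G x y.

Definition ginv (x : V) : V := - x.

(* The left-invariant field X_I: the image of e_I under the differential at the
   identity of the left translation by x. *)
Definition lvf (I : 'I_(h + m)) (x : V) : V := 'D_(e_ R I) (gmul x) 0.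

Definition vf_bracket (X Y : V -> V) (x : V) : V :=
  'D_(X x) Y x - 'D_(Y x) X x.

(* The left-invariant metric making X_1, ..., X_n orthonormal: tangent vectors
   at x are carried to the identity by the translation by x^-1, where the X_I
   are the standard basis. *)
Definition metric (x u v : V) : R :=
  dotv ('D_u (gmul (ginv x)) x) ('D_v (gmul (ginv x)) x).

(* C^K_IJ = <[X_I, X_J], X_K>. The fields and the metric being left-invariant,
   this function on the group is constant; it is read off at the identity. *)
Definition structural_constant (K I J : 'I_(h + m)) : R :=
  metric 0 (vf_bracket (lvf I) (lvf J) 0) (lvf K 0).

Definition CH (a : 'I_m) : 'M[R]_h :=
  \matrix_(i < h, j < h)
    structural_constant (rshift h a) (lshift m i) (lshift m j).

Definition CHof (q : 'cV[R]_m) : 'M[R]_h := \sum_(a < m) q a 0 *: CH a.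

(* x is the curve exp_SR(x0, P0). P t is the column of the components of the
   momentum in the frame X_1, ..., X_n: its upper block is P_H, its lower block
   is P_{H_2}. *)
Definition normal_CC_geodesic (x0 P0 : V) (x : R -> V) : Prop :=
  exists P : R -> V,
  [/\ forall t : R, is_derive t 1 x
        (\sum_(i < h) P t (lshift m i) 0 *: lvf (lshift m i) (x t)),
      forall t : R, is_derive t 1 (fun s => usubmx (P s))
        (- (CHof (dsubmx (P t)) *m usubmx (P t))),
      forall t : R, is_derive t 1 (fun s => dsubmx (P s)) 0,
      x 0 = x0
    & P 0 = P0].

End CarnotGroup.

(* Main.v *)
Require Import Defs.
From HB Require Import structures.
From mathcomp Require Import all_boot all_order all_algebra.
From mathcomp Require Import all_classical all_reals all_analysis.
Set Implicit Arguments.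
Unset Strict Implicit.
Unset Printing Implicit Defensive.
Import Order.TTheory GRing.Theory Num.Theory.
Import numFieldNormedType.Exports.
Local Open Scope classical_set_scope.
Local Open Scope ring_scope.

(* The upper block of the geodesic equations is the linear flow P_H' = -C P_H, whose
   matrix is skew-symmetric, so that |P_H - e^{-Ct} P_H(0)|^2 is constant and
   P_H = e^{-Ct} P_H(0). Since X_i(x) = e_i + [x, e_i] / 2 in exponential coordinates,
   the equation for x then reads x_H' = P_H and x_a' = - <C_H^a x_H, P_H> / 2 on the
   vertical coordinates. Both x and the closed formula solve it with the same initial
   value. *)

(** * Derivatives of vector- and matrix-valued functions, entry by entry *)

Lemma is_derive_mxP (R : realFieldType) (V : normedModType R) (m n : nat)
    (M : V -> 'M[R]_(m, n)) (t v : V) (D : 'M[R]_(m, n)) :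
  is_derive t v M D <-> forall i j, is_derive t v (fun x => M x i j) (D i j).
Proof.
split=> [[dM <-] i j|dM].
  by apply: DeriveDef; [move/derivable_mxP: dM|rewrite derive_mx// mxE].
have dM' : derivable M t v by apply/derivable_mxP => i j; have [] := dM i j.
apply: DeriveDef => //; rewrite derive_mx//.
by apply/matrixP => i j; rewrite mxE; have [] := dM i j.
Qed.

(** Each entry of [f - g] has zero derivative, hence is constant. This gives uniqueness for
    equations whose right-hand side is a known function of time. *)
Lemma is_derive_eq_mx (R : realType) (m n : nat) (f g D : R -> 'M[R]_(m, n)) :
  (forall t : R, is_derive t 1 f (D t)) -> (forall t : R, is_derive t 1 g (D t)) ->
  f 0 = g 0 -> f =1 g.
Proof.
move=> df dg fg0 t; apply/matrixP => i j; apply/eqP; rewrite -subr_eq0.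
have -> : f t i j - g t i j = f 0 i j - g 0 i j.
  apply: (@is_derive_0_is_cst _ (fun s => f s i j - g s i j)) => s.
  rewrite -(subrr (D s i j)); apply: is_deriveB.
    by move/is_derive_mxP : (df s).
  by move/is_derive_mxP : (dg s).
by rewrite fg0 subrr.
Qed.

Lemma is_derive_mulmx (R : realFieldType) (V : normedModType R) (m n p : nat)
    (A : 'M[R]_(m, n)) (f : V -> 'M[R]_(n, p)) (t v : V) D :
  is_derive t v f D -> is_derive t v (fun s => A *m f s) (A *m D).
Proof.
move=> /is_derive_mxP df; apply/is_derive_mxP => i j; rewrite mxE.
rewrite [X in is_derive _ _ X _](_ : _ =
    \sum_(k < n) (A i k \*: (fun s => f s k j))).
  by apply: is_derive_sum => k; exact: is_deriveZ.
by apply/funext => s; rewrite fct_sumE mxE.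
Qed.

Lemma is_derive_mulmxr (R : realFieldType) (V : normedModType R) (m n p : nat)
    (f : V -> 'M[R]_(m, n)) (A : 'M[R]_(n, p)) (t v : V) D :
  is_derive t v f D -> is_derive t v (fun s => f s *m A) (D *m A).
Proof.
move=> /is_derive_mxP df; apply/is_derive_mxP => i j; rewrite mxE.
rewrite [X in is_derive _ _ X _](_ : _ =
    \sum_(k < n) (A k j \*: (fun s => f s i k))).
  apply: is_derive_sum => k; rewrite mulrC; exact: is_deriveZ.
by apply/funext => s; rewrite fct_sumE mxE; apply: eq_bigr => k _; rewrite mulrC.
Qed.

Lemma is_derive_dotv (R : realType) (n : nat) (f g : R -> 'cV[R]_n) (t : R)
    (df dg : 'cV[R]_n) :
  is_derive t 1 f df -> is_derive t 1 g dg ->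
  is_derive t 1 (fun s => dotv (f s) (g s)) (dotv (f t) dg + dotv df (g t)).
Proof.
move=> /is_derive_mxP hf /is_derive_mxP hg.
rewrite /dotv -big_split [X in is_derive _ _ X _](_ : _ =
    \sum_(k < n) ((fun s => f s k 0) * (fun s => g s k 0))); last first.
  by apply/funext => s; rewrite fct_sumE.
apply: is_derive_sum => k; rewrite (mulrC (df k 0)).
exact: is_deriveM.
Qed.

Lemma is_derive_col_mx (R : realFieldType) (V : normedModType R) (m1 m2 n : nat)
    (f : V -> 'M[R]_(m1, n)) (g : V -> 'M[R]_(m2, n)) (t v : V) df dg :
  is_derive t v f df -> is_derive t v g dg ->
  is_derive t v (fun s => col_mx (f s) (g s)) (col_mx df dg).
Proof.
move=> /is_derive_mxP hf /is_derive_mxP hg; apply/is_derive_mxP => i j.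
case: (split_ordP i) => k ->.
  by rewrite col_mxEu; under eq_fun do rewrite col_mxEu.
by rewrite col_mxEd; under eq_fun do rewrite col_mxEd.
Qed.

Lemma is_derive_usubmx (R : realFieldType) (V : normedModType R)
    (m1 m2 n : nat) (f : V -> 'M[R]_(m1 + m2, n)) (t v : V) D :
  is_derive t v f D -> is_derive t v (fun s => usubmx (f s)) (usubmx D).
Proof.
move=> /is_derive_mxP df; apply/is_derive_mxP => i j; rewrite mxE.
by under eq_fun do rewrite mxE.
Qed.

Lemma is_derive_continuous (R : realType) (f df : R -> R) :
  (forall t : R, is_derive t 1 f (df t)) -> continuous f.
Proof.
by move=> hf t; apply/differentiable_continuous/derivable1_diffP; case: (hf t).
Qed.

(** The difference quotient equals [w] for every nonzero [k], so its limit is immediate. The group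
    law is affine in each argument, so this computes every directional derivative hidden in [lvf],
    [vf_bracket] and [metric]. *)
Lemma derive_affine (R : realType) (V W : normedModType R) (f : V -> W)
    (x v : V) (w : W) :
  (forall k : R, f (k *: v + x) - f x = k *: w) -> 'D_v f x = w.
Proof.
move=> fE; apply: cvg_lim => //.
apply: cvg_near_cst; near=> k.
by rewrite /= fE scalerA mulVf ?scale1r//; near: k; exact: nbhs_dnbhs_neq.
Unshelve. all: by end_near. Qed.

(** * The fundamental theorem of calculus for the oriented integral *)

Lemma continuous_integrable_itv (R : realType) (f : R -> R) (a b : R) :
  continuous f -> lebesgue_measure.-integrable `[a, b] (EFin \o f).
Proof.
move=> cf; apply: continuous_compact_integrable; first exact: segment_compact.
exact: continuous_subspaceT.
Qed.

(** A base point [c] to the left of both endpoints removes the case distinction in [oint], leaving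
    ordinary integrals with a fixed lower bound. *)
Lemma oint_split (R : realType) (f : R -> R) (c a b : R) :
  continuous f -> c <= a -> c <= b ->
  oint a b f = \int[lebesgue_measure]_(s in `[c, b]) f s
             - \int[lebesgue_measure]_(s in `[c, a]) f s.
Proof.
move=> cf; wlog ab : a b / a <= b => [H|ca cb].
  case: (leP a b) => [|/[dup]/ltW ba]; first exact: H.
  rewrite ltNge => /negbTE ab ca cb; rewrite /oint ab.
  have := H b a ba cb ca; rewrite /oint ba => ->.
  by rewrite opprB.
rewrite /oint ab Rintegral_itvB//; first last.
  exact: continuous_integrable_itv.
(* The subtraction leaves an interval open at [a]; the missing endpoint has measure zero. *)
rewrite Rintegral_itv_obnd_cbnd//.
apply: integrableS (continuous_integrable_itv a b cf) => //.
apply: subset_itv => //; rewrite bnd_simp//.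
Qed.

Lemma is_derive_oint (R : realType) (f : R -> R) (t : R) :
  continuous f -> is_derive t 1 (fun b => oint 0 b f) (f t).
Proof.
(* This [c] lies strictly to the left of both 0 and [t], whatever the sign of [t]. Hence for [b]
   near [t] the integral from 0 to [b] is [F b - F 0], where [F] integrates from [c]. *)
move=> cf; pose c := Num.min 0 t - 1.
have ct : c < t by rewrite ltrBlDr gt_min ltrDl ltr01 orbT.
have c0 : c < 0 by rewrite ltrBlDr gt_min ltrDl ltr01.
have tt1 : t < t + 1 by rewrite ltrDl.
have := continuous_FTC1_closed tt1
  (continuous_integrable_itv c (t + 1) cf) ct (cf t).
set F := (fun x : R => Rintegral _ _ _) => -[dF].
rewrite derive1E => Ff.
apply: (@near_eq_is_derive _ _ _ (fun b => F b - F 0)).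
  near=> b; rewrite (@oint_split _ _ c)//; first exact: ltW.
  by apply: ltW; near: b; exact: lt_nbhsr.
rewrite -[X in is_derive _ _ _ X]subr0.
apply: is_deriveB.
by apply: DeriveDef.
Unshelve. all: by end_near. Qed.

(** * The matrix exponential as a power series in time *)

(* [r] is the number of term-by-term derivatives taken of s |-> (e^{sB})_ij. *)
Definition expmx_coef (R : realType) (n : nat) (B : 'M[R]_n) (r : nat)
    (i j : 'I_n) (k : nat) : R := (k`!%:R)^-1 * (B ^+ (k + r)) i j.

Lemma pseries_diffs_expmx_coef (R : realType) (n : nat) (B : 'M[R]_n) r i j :
  pseries_diffs (expmx_coef B r i j) = expmx_coef B r.+1 i j.
Proof.
apply/funext => k; rewrite /pseries_diffs /expmx_coef factS natrM invfM.
by rewrite -mulrA mulVKf// addSnnS.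
Qed.

(** The sum of all absolute entries dominates every row sum, so each further factor [B] costs at
    most a factor [b]. *)
Lemma normr_exprmx (R : realType) (n : nat) (B : 'M[R]_n) k i j :
  `|(B ^+ k) i j| <= (\sum_p \sum_q `|B p q|) ^+ k.
Proof.
set b := \sum_p _.
elim: k i j => [|k IH] i j.
  by rewrite !expr0 mxE; case: eqP => _; rewrite ?normr1 ?normr0.
rewrite exprS mxE; apply: le_trans (ler_norm_sum _ _ _) _.
apply: (@le_trans _ _ (\sum_q `|B i q| * b ^+ k)).
  by apply: ler_sum => q _; rewrite normrM ler_wpM2l.
rewrite -mulr_suml exprS ler_wpM2r ?exprn_ge0//.
  by apply: sumr_ge0 => p _; exact: sumr_ge0.
rewrite [leRHS](bigD1 i)//= lerDl.
by apply: sumr_ge0 => p _; exact: sumr_ge0.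
Qed.

(** By [normr_exprmx], the terms are dominated by [b ^+ r] times those of a scalar exponential
    series, so the series converges for every [s]. *)
Lemma is_cvg_expmx_coef (R : realType) (n : nat) (B : 'M[R]_n) r i j (s : R) :
  cvgn (pseries (expmx_coef B r i j) s).
Proof.
set b := \sum_p \sum_q `|B p q|.
have b0 : 0 <= b by apply: sumr_ge0 => p _; exact: sumr_ge0.
apply: normed_cvg.
apply: (@series_le_cvg _ _ (fun k => b ^+ r * exp_coeff (b * `|s|) k)) => //.
- by move=> k /=.
- by move=> k; rewrite mulr_ge0 ?exprn_ge0// exp_coeff_ge0// mulr_ge0.
- move=> k /=; rewrite /expmx_coef !normrM normfV normr_nat normrX.
  rewrite [leRHS](_ : _ = (k`!%:R)^-1 * b ^+ (k + r) * `|s| ^+ k).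
    by rewrite ler_wpM2r// ler_wpM2l// normr_exprmx.
  rewrite /exp_coeff/= exprMn exprD mulrC -!mulrA [RHS]mulrCA.
  by congr (_ * _); rewrite mulrCA (mulrC (_ ^+ r)).
- by apply: is_cvg_seriesZ; exact: is_cvg_series_exp_coeff.
Qed.

Lemma exprmxZ (R : comPzRingType) (n : nat) (a : R) (A : 'M[R]_n) k :
  (a *: A) ^+ k = a ^+ k *: A ^+ k.
Proof.
elim: k => [|k IH]; first by rewrite !expr0 scale1r.
by rewrite !exprS IH -[LHS]/(_ *m _) -scalemxAl -scalemxAr scalerA.
Qed.

Lemma cvg_mx (R : realType) (m n : nat) (u : nat -> 'M[R]_(m, n))
    (L : 'M[R]_(m, n)) :
  (forall i j, (fun k => u k i j) @ \oo --> L i j) -> u @ \oo --> L.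
Proof.
move=> uL; apply/cvgrPdist_le => /= e e0; near=> x.
rewrite /Num.Def.normr/= mx_normrE (bigmax_le _ (ltW e0))//= => i _.
rewrite !mxE/=; move: i; near: x; apply: filter_forall => /= -[i j].
by have /cvgrPdist_le := uL i j; exact.
Unshelve. all: by end_near. Qed.

Lemma expmxE (R : realType) (n : nat) (B : 'M[R]_n) (s : R) i j :
  expmx (s *: B) i j = limn (pseries (expmx_coef B 0 i j) s).
Proof.
pose L := \matrix_(i, j) limn (pseries (expmx_coef B 0 i j) s).
suff -> : expmx (s *: B) = L by rewrite mxE.
apply/cvg_lim => //; apply: cvg_mx => {}i {}j; rewrite mxE.
rewrite (_ : (fun N => _) = pseries (expmx_coef B 0 i j) s).
  exact: is_cvg_expmx_coef.
apply/funext => N; rewrite /pseries /series/= summxE; apply: eq_bigr => k _.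
by rewrite exprmxZ !mxE /expmx_coef addn0 -mulrA (mulrC (s ^+ k)).
Qed.

(** Splitting one factor [B] off [B ^+ k.+1] turns the differentiated series into a finite
    combination of the entries of the exponential series, and limits commute with finite sums. *)
Lemma lim_expmx_coef1 (R : realType) (n : nat) (B : 'M[R]_n) (s : R) i j :
  limn (pseries (expmx_coef B 1 i j) s) = (B *m expmx (s *: B)) i j.
Proof.
apply/cvg_lim => //; rewrite mxE.
rewrite (_ : pseries _ _ =
    fun N => \sum_l B i l * pseries (expmx_coef B 0 l j) s N).
  apply: cvg_big => [|l _]; first exact: add_continuous.
  rewrite expmxE; apply: cvgMr.
  exact: is_cvg_expmx_coef.
apply/funext => N; rewrite /pseries /series/=.
under [RHS]eq_bigr do rewrite mulr_sumr.
rewrite exchange_big; apply: eq_bigr => k _.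
rewrite /expmx_coef addn1 addn0 exprS mxE mulr_sumr mulr_suml.
by apply: eq_bigr => l _; rewrite !mulrA (mulrC (B i l)).
Qed.

Lemma is_derive_expmx (R : realType) (n : nat) (B : 'M[R]_n) (s : R) :
  is_derive s 1 (fun s => expmx (s *: B)) (B *m expmx (s *: B)).
Proof.
apply/is_derive_mxP => i j; under eq_fun do rewrite expmxE.
rewrite -lim_expmx_coef1 -pseries_diffs_expmx_coef.
(* Term-by-term differentiation at [s] needs the series and its first two formal derivatives to
   converge at a point of larger modulus. *)
apply: (@pseries_snd_diffs _ _ (`|s| + 1)).
- exact: is_cvg_expmx_coef.
- by rewrite pseries_diffs_expmx_coef; exact: is_cvg_expmx_coef.
- by rewrite !pseries_diffs_expmx_coef; exact: is_cvg_expmx_coef.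
- by rewrite [ltRHS]ger0_norm ?addr_ge0// ltrDl.
Qed.

Lemma expmx0 (R : realType) (n : nat) : expmx 0 = 1%:M :> 'M[R]_n.
Proof.
apply/cvg_lim => //; apply: cvg_near_cst; near=> N.
(* The empty partial sum is 0; every later one consists of the identity term and zeros. *)
have N0 : (0 < N)%N by near: N; exact: nbhs_infty_gt.
rewrite /series/= big_mkord -(prednK N0) big_ord_recl big1 => [|k _].
  by rewrite fact0 invr1 scale1r addr0.
by rewrite /= expr0n scaler0.
Unshelve. all: by end_near. Qed.

(** * Skew-symmetric matrices, block columns and the two layers *)

Lemma dotv_skew (R : realType) (n : nat) (A : 'M[R]_n) (u v : 'cV[R]_n) :
  A^T = - A -> dotv u (A *m v) = - dotv (A *m u) v.
Proof.
have dotvE (a b : 'cV[R]_n) : dotv a b = (a^T *m b) 0 0.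
  by rewrite mxE; apply: eq_bigr => i _; rewrite mxE.
move=> AT; rewrite !dotvE trmx_mul AT mulmxN mulNmx mulmxA.
by rewrite [X in _ = - X]mxE opprK.
Qed.

Lemma col_mx0E (R : realType) (h m : nat) (u : 'cV[R]_h) :
  col_mx u 0 = \sum_(i < h) u i 0 *: e_ R (lshift m i).
Proof.
apply/colP => j; rewrite summxE; case: (split_ordP j) => k ->.
  rewrite col_mxEu (bigD1 k)//= big1 ?addr0; first by rewrite !mxE !eqxx mulr1.
  by move=> i ik; rewrite !mxE (inj_eq (@lshift_inj _ _)) eq_sym (negbTE ik) mulr0.
by rewrite col_mxEd big1 ?mxE// => i _; rewrite !mxE eq_rlshift mulr0.
Qed.

Lemma col_0mxE (R : realType) (h m : nat) (v : 'cV[R]_m) :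
  col_mx 0 v = \sum_(a < m) v a 0 *: e_ R (rshift h a).
Proof.
apply/colP => j; rewrite summxE; case: (split_ordP j) => k ->.
  by rewrite col_mxEu big1 ?mxE// => i _; rewrite !mxE eq_lrshift mulr0.
rewrite col_mxEd (bigD1 k)//= big1 ?addr0; first by rewrite !mxE !eqxx mulr1.
by move=> i ik; rewrite !mxE (inj_eq (@rshift_inj _ _)) eq_sym (negbTE ik) mulr0.
Qed.

Lemma horizontal_col_mx (R : realType) (h m : nat) (u : 'cV[R]_h) :
  col_mx u 0 \in horizontal R h m.
Proof.
rewrite col_mx0E; apply: memv_suml => i _; apply/memvZ/memv_span/map_f.
by rewrite mem_enum.
Qed.

Lemma vertical_col_mx (R : realType) (h m : nat) (v : 'cV[R]_m) :
  col_mx 0 v \in vertical R h m.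
Proof.
rewrite col_0mxE; apply: memv_suml => i _; apply/memvZ/memv_span/map_f.
by rewrite mem_enum.
Qed.

Lemma usubmx_vertical (R : realType) (h m : nat) (v : 'cV[R]_(h + m)) :
  v \in vertical R h m -> usubmx v = 0.
Proof.
move=> vV; apply/colP => i; rewrite !mxE.
(* The i-th horizontal coordinate is a linear form that kills every vector spanning the vertical
   layer, so that layer lies in its kernel. *)
have : (vertical R h m <=
    lker (linfun (fun w : 'cV[R]_(h + m) => row (lshift m i) w)))%VS.
  apply/span_subvP => _ /mapP[a _ ->]; rewrite memv_ker lfunE/=.
  apply/eqP/rowP => j; rewrite !mxE.
  by rewrite (ord1 j) eq_lrshift.
move=> /subvP/(_ _ vV); rewrite memv_ker lfunE/= => /eqP/rowP/(_ 0).
by rewrite !mxE.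
Qed.

(** * The bracket, the left-invariant fields and the structural constants *)

Section Carnot.
Context (R : realType) (h m : nat) (G : carnot2 R h m).

Lemma lieDl u v w : G (u + v) w = G u w + G v w.
Proof. by have := lie_linearl G 1 u v w; rewrite !scale1r. Qed.

Lemma lieDr u v w : G w (u + v) = G w u + G w v.
Proof. by have := lie_linearr G 1 u v w; rewrite !scale1r. Qed.

Lemma lie0l w : G 0 w = 0.
Proof. by apply: (addrI (G 0 w)); rewrite -lieDl !addr0. Qed.

Lemma lie0r w : G w 0 = 0.
Proof. by apply: (addrI (G w 0)); rewrite -lieDr !addr0. Qed.

Lemma lieZl a u w : G (a *: u) w = a *: G u w.
Proof. by have := lie_linearl G a u 0 w; rewrite lie0l !addr0. Qed.

Lemma lieZr a u w : G w (a *: u) = a *: G w u.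
Proof. by have := lie_linearr G a u 0 w; rewrite lie0r !addr0. Qed.

Lemma lie_suml n (u : 'I_n -> 'cV_(h + m)) w :
  G (\sum_i u i) w = \sum_i G (u i) w.
Proof. by apply: (big_morph (G^~ w)) => [x y|]; rewrite ?lieDl ?lie0l. Qed.

Lemma lie_sumr n (u : 'I_n -> 'cV_(h + m)) w :
  G w (\sum_i u i) = \sum_i G w (u i).
Proof. by apply: (big_morph (G w)) => [x y|]; rewrite ?lieDr ?lie0r. Qed.

(** [bracketv] is spanned by brackets of basis vectors only; bilinearity extends membership to all
    of [U] and [W]. *)
Lemma bracketv_mem (U W : {vspace 'cV[R]_(h + m)}) u w :
  u \in U -> w \in W -> G u w \in bracketv G U W.
Proof.
move=> /coord_vbasis -> /coord_vbasis ->; rewrite lie_suml memv_suml// => i _.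
rewrite lieZl lie_sumr memvZ// memv_suml// => j _; rewrite lieZr memvZ//.
by rewrite memv_span//; apply: allpairs_f; apply: mem_nth; rewrite size_tuple.
Qed.

Lemma lieC u v : G v u = - G u v.
Proof.
apply/eqP; rewrite -addr_eq0 addrC; apply/eqP.
by have := lie_alt G (u + v); rewrite lieDl !lieDr !lie_alt add0r addr0.
Qed.

Lemma lvfE I x : lvf G I x = e_ R I + 2^-1 *: G x (e_ R I).
Proof.
apply: derive_affine => k; rewrite /gmul !addr0 lie0r scaler0 addr0 lieZr.
by rewrite scalerDr (addrC x) addrAC addrK !scalerA (mulrC k).
Qed.

(** Translation by the identity is trivial, so the metric there is Euclidean. Each directional
    derivative of a field contributes half a bracket, and antisymmetry adds the two halves up to the
    Lie bracket. *)
Lemma structural_constantE K I J :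
  structural_constant G K I J = G (e_ R I) (e_ R J) K 0.
Proof.
have D I' J' : 'D_(lvf G I' 0) (lvf G J') 0 = 2^-1 *: G (e_ R I') (e_ R J').
  apply: derive_affine => k; rewrite !lvfE !addr0 !lie0l scaler0 !addr0 lieZl.
  by rewrite addrC addKr !scalerA (mulrC k).
have M u : 'D_u (gmul G (ginv 0)) 0 = u.
  apply: derive_affine => k; rewrite /gmul /ginv oppr0 !lie0l scaler0 !addr0.
  by rewrite add0r subr0.
rewrite /structural_constant /metric /vf_bracket !M !D lvfE lie0l scaler0 addr0.
rewrite (lieC (e_ R I)) scalerN opprK -scalerDl.
rewrite [X in X *: _](_ : _ = 1) ?scale1r; last first.
  by rewrite [RHS]splitr !mul1r.
rewrite /dotv (bigD1 K)//= big1 ?addr0; first by rewrite !mxE !eqxx mulr1.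
by move=> i iK; rewrite !mxE (negbTE iK) mulr0.
Qed.

Lemma CH_skew a : (CH G a)^T = - CH G a.
Proof.
by apply/matrixP => i j; rewrite !mxE !structural_constantE lieC mxE.
Qed.

Lemma CHof_skew q : (CHof G q)^T = - CHof G q.
Proof.
rewrite /CHof raddf_sum -sumrN; apply: eq_bigr => a _.
by rewrite -scalerN -CH_skew; apply/matrixP => i j; rewrite !mxE.
Qed.

(** The vertical part of [x] drops out because [H, H_2] = 0. What remains is a bracket of horizontal
    vectors, which is vertical, with coordinates given by the structural constants. *)
Lemma lie_horizontal x p :
  G x (col_mx p 0) = col_mx 0 (\col_a dotv (usubmx x) (CH G a *m p)).
Proof.
have lieV u v : G (col_mx u 0) (col_mx 0 v) = 0.
  apply/eqP; rewrite -memv0 -(lie_HH2 G).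
  by apply: bracketv_mem; [exact: horizontal_col_mx|exact: vertical_col_mx].
rewrite -{1}(vsubmxK x).
have -> : col_mx (usubmx x) (dsubmx x) =
    col_mx (usubmx x) 0 + col_mx 0 (dsubmx x).
  by rewrite add_col_mx addr0 add0r.
rewrite lieDl (lieC _ (col_mx 0 _)) lieV oppr0 addr0.
move: (usubmx x) => u.
rewrite -[LHS]vsubmxK usubmx_vertical; last first.
  by rewrite -(lie_HH G); apply: bracketv_mem; exact: horizontal_col_mx.
congr col_mx; apply/colP => a; rewrite !mxE [in LHS]col_mx0E lie_suml summxE.
apply: eq_bigr => i _; rewrite lieZl mxE; congr (_ * _).
rewrite col_mx0E lie_sumr summxE mxE; apply: eq_bigr => j _.
by rewrite lieZr !mxE structural_constantE mulrC.
Qed.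

(** This is the velocity in block form. The minus sign comes from moving the skew matrix [CH G a] to
    the other side of the inner product. *)
Lemma horizontal_lvf (p : 'cV[R]_h) x :
  \sum_(i < h) p i 0 *: lvf G (lshift m i) x =
  col_mx p (- (2^-1 *: \col_a dotv (CH G a *m usubmx x) p)).
Proof.
transitivity (col_mx p 0 + 2^-1 *: G x (col_mx p 0)).
  rewrite col_mx0E lie_sumr scaler_sumr -big_split; apply: eq_bigr => i _.
  by rewrite lvfE scalerDr lieZr !scalerA (mulrC (2^-1)).
rewrite lie_horizontal scale_col_mx scaler0 add_col_mx add0r addr0.
congr col_mx; rewrite -scalerN; congr (_ *: _); apply/colP => a; rewrite !mxE.
by rewrite dotv_skew ?CH_skew.
Qed.

End Carnot.

(** * Uniqueness of the momentum flow, and the geodesic formula *)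

Lemma sum_vertical_col_mx (R : realType) (h m : nat) (c : 'I_m -> R) :
  \sum_(a < m) c a *: e_ R (rshift h a) = col_mx 0 (\col_a c a).
Proof. by rewrite col_0mxE; apply: eq_bigr => a _; rewrite mxE. Qed.

Lemma oint0 (R : realType) (f : R -> R) a : oint a a f = 0.
Proof. by rewrite /oint lexx set_itv1 Rintegral_set1. Qed.

(* The difference of two solutions keeps its Euclidean norm, because the matrix of
   the equation is skew-symmetric. *)
Lemma skew_flow_unique (R : realType) (n : nat) (A : 'M[R]_n)
    (f g : R -> 'cV[R]_n) :
  A^T = - A ->
  (forall t : R, is_derive t 1 f (A *m f t)) ->
  (forall t : R, is_derive t 1 g (A *m g t)) ->
  f 0 = g 0 -> f =1 g.
Proof.
move=> AT df dg fg0 t; pose d s := f s - g s.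
have dd (s : R) : is_derive s 1 d (A *m d s).
  by rewrite /d mulmxBr; apply: is_deriveB.
have d0 : dotv (d t) (d t) = 0.
  transitivity (dotv (d 0) (d 0)).
    apply: (@is_derive_0_is_cst _ (fun s => dotv (d s) (d s))) => s.
    have := is_derive_dotv (dd s) (dd s).
    by rewrite (dotv_skew _ _ AT) addNr.
  by rewrite /d fg0 subrr /dotv big1// => i _; rewrite mxE mul0r.
apply/eqP; rewrite -subr_eq0; apply/eqP/colP => i; rewrite [RHS]mxE.
have := d0; rewrite /dotv => /eqP; rewrite psumr_eq0 => [|k _]; last first.
  by rewrite -expr2 sqr_ge0.
by move=> /allP/(_ i (mem_index_enum _)); rewrite /= mulf_eq0 orbb => /eqP.
Qed.

Lemma is_derive_vint (R : realType) (n : nat) (f : R -> 'cV[R]_n) (t : R) :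
  (forall i, continuous (fun s => f s i 0)) ->
  is_derive t 1 (fun b => vint 0 b f) (f t).
Proof.
move=> cf; apply/is_derive_mxP => i j; rewrite (ord1 j).
rewrite [X in is_derive _ _ X _](_ : _ = fun b => oint 0 b (fun s => f s i 0)).
  exact: is_derive_oint.
by apply/funext => b; rewrite mxE.
Qed.

Theorem mainTheorem6 (R : realType) (h m : nat) (G : carnot2 R h m)
    (x0 P0 : 'cV[R]_(h + m)) (hP0 : enorm (usubmx P0) = 1)
    (x : R -> 'cV[R]_(h + m)) :
  let C := CHof G (dsubmx P0) in
  let y : R -> 'cV[R]_h := fun t => vint 0 t (fun s => expmx (- (s *: C)) *m usubmx P0) in
  let xH : R -> 'cV[R]_h := fun t => usubmx x0 + y t in
  normal_CC_geodesic G x0 P0 x <->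
  forall t : R,
    x t = x0 + col_mx (y t) 0
          - 2^-1 *: \sum_(a < m)
              oint 0 t (fun s => dotv (CH G a *m xH s) (derive1 xH s))
                *: e_ R (rshift h a).
Proof.
move=> C y xH.
pose p (t : R) := expmx (- (t *: C)) *m usubmx P0.
have dp (t : R) : is_derive t 1 p (- C *m p t).
  have -> : p = fun s : R => expmx (s *: - C) *m usubmx P0.
    by apply/funext => s; rewrite scalerN.
  rewrite mulmxA; exact/is_derive_mulmxr/is_derive_expmx.
have p0 : p 0 = usubmx P0 by rewrite /p scale0r oppr0 expmx0 mul1mx.
(* The integrand [p] is differentiable, hence continuous, so the fundamental theorem applies. *)
have dy (t : R) : is_derive t 1 y (p t).
  apply: is_derive_vint => i; apply: is_derive_continuous => s.
  by move/is_derive_mxP : (dp s).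
have dxH (t : R) : is_derive t 1 xH (p t).
  by rewrite -[p t]add0r; apply: is_deriveD.
have dxHE : derive1 xH = p.
  by apply/funext => s; rewrite derive1E; have [] := dxH s.
rewrite dxHE.
pose g a (s : R) := dotv (CH G a *m xH s) (p s).
pose z (t : R) := \col_a oint 0 t (g a).
pose dz (t : R) := \col_a g a t.
have dzE (t : R) : is_derive t 1 z (dz t).
  apply/is_derive_mxP => a j; rewrite (ord1 j) mxE.
  rewrite [X in is_derive _ _ X _](_ : _ = fun b => oint 0 b (g a)).
    apply: is_derive_oint; apply: is_derive_continuous => s.
    by apply: is_derive_dotv; first exact: is_derive_mulmx.
  by apply/funext => b; rewrite mxE.
pose F (t : R) : 'cV[R]_(h + m) := x0 + col_mx (y t) 0 - 2^-1 *: col_mx 0 (z t).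
have -> : (forall t, x t = x0 + col_mx (y t) 0 - 2^-1 *: \sum_(a < m)
    oint 0 t (fun s => dotv (CH G a *m xH s) (p s)) *: e_ R (rshift h a)) =
    (x =1 F).
  by apply/propext; split => xF t; rewrite xF sum_vertical_col_mx.
have F0 : F 0 = x0.
  have y0 : y 0 = 0 by apply/colP => i; rewrite !mxE oint0.
  have z0 : z 0 = 0 by apply/colP => i; rewrite !mxE oint0.
  by rewrite /F y0 z0 col_mx0 scaler0 subr0 addr0.
have FH t : usubmx (F t) = xH t.
  by rewrite /F !linearD/= linearN linearZ/= !col_mxKu scaler0 subr0.
pose W t := col_mx (p t) (- (2^-1 *: dz t)).
have dF (t : R) : is_derive t 1 F (W t).
  have -> : W t = 0 + col_mx (p t) 0 - 2^-1 *: col_mx 0 (dz t).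
    by rewrite add0r scale_col_mx scaler0 opp_col_mx add_col_mx subr0 add0r.
  apply: is_deriveB.
    by apply: is_deriveD; exact: is_derive_col_mx.
  by apply: is_deriveZ; exact: is_derive_col_mx.
(* The velocity depends on the position only through its horizontal block, so once that block is
   known to be [xH] the right-hand side is the explicit function [W] of time. *)
have WE v t : usubmx v = xH t ->
    \sum_(i < h) p t i 0 *: lvf G (lshift m i) v = W t.
  by move=> vH; rewrite horizontal_lvf vH.
split=> [[P [dx dPH dPV x0E P0E]] | xF].
  (* The vertical momentum is constant, which freezes the matrix of the horizontal momentum equation
     at [C]. *)
  have PV t : dsubmx (P t) = dsubmx P0.
    rewrite -P0E; apply: (is_derive_eq_mx (D := fun=> 0)
      (g := fun=> dsubmx (P 0))) => //.
  have PH : (fun t => usubmx (P t)) =1 p.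
    apply: (@skew_flow_unique _ _ (- C)) => //; last by rewrite P0E p0.
      by rewrite linearN/= CHof_skew.
    by move=> t; have := dPH t; rewrite PV mulNmx.
  have {}dx (t : R) : is_derive t 1 x
      (\sum_(i < h) p t i 0 *: lvf G (lshift m i) (x t)).
    by under eq_bigr => i _ do rewrite -PH mxE.
  (* The horizontal block is determined first, since its velocity is just [p]; this gives access to
     [WE] for the full curve. *)
  have xHE : (fun t => usubmx (x t)) =1 xH.
    apply: (is_derive_eq_mx _ dxH) => [t|]; last by rewrite x0E -F0 FH.
    by have := is_derive_usubmx (dx t); rewrite horizontal_lvf col_mxKu.
  apply: (is_derive_eq_mx (D := W)) => // [t|]; last by rewrite x0E F0.
  by rewrite -(WE (x t)).
have {xF}-> : x = F by exact/funext.
(* The momentum is rebuilt from the exponential flow on the horizontal block and the constant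
   initial value on the vertical one. *)
exists (fun t => col_mx (p t) (dsubmx P0)); split => //.
- by move=> t; under eq_bigr => i _ do rewrite col_mxEu; rewrite WE.
- move=> t; rewrite col_mxKu col_mxKd -mulNmx.
  by under eq_fun do rewrite col_mxKu.
- by move=> t; under eq_fun do rewrite col_mxKd; exact: is_derive_cst.
- by rewrite p0 vsubmxK.
Qed.
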